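(* Let $R$ be a unital ring and $a,b,c\in R$. Then the following are equivalent: (1) there exists $y\in R$ such that $aya=a$ and $y$ is the $(b,c)$-inverse of $a$; (2) $a$ is regular, $aR=abR$, $Rca=Ra$, $(ab)^{\circ}=b^{\circ}$ and ${}^{\circ}(ca)={}^{\circ}c$; (3) $a$ is regular, $R=a^{\circ}\oplus bR$ and $R={}^{\circ}a\oplus Rc$.
   Context: For $x\in R$: $xR=\{xr\mid r\in R\}$, $Rx=\{rx\mid r\in R\}$, ${}^{\circ}x=\{r\in R\mid rx=0\}$, $x^{\circ}=\{r\in R\mid xr=0\}$. An element $x\in R$ is regular if there exists $z\in R$ with $xzx=x$. The symbol $\oplus$ denotes the internal direct sum of one-sided ideals (sum equal to $R$, intersection $\{0\}$). For $a,b,c\in R$, an element $y\in R$ is the $(b,c)$-inverse of $a$ if $y\in (bRy)\cap (yRc)$, $yab=b$ and $cay=c$, where $bRy=\{bry\mid r\in R\}$ and $yRc=\{yrc\mid r\in R\}$; such $y$ is unique if it exists. *)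

(* Defs.v *)
From mathcomp Require Import all_boot all_algebra.
From mathcomp Require Import boolp classical_sets.

Set Implicit Arguments.
Unset Strict Implicit.
Unset Printing Implicit Defensive.

Import GRing.Theory.
Local Open Scope classical_set_scope.
Local Open Scope ring_scope.

(* A unital, associative, not necessarily commutative ring is a [pzRingType];
   the zero ring is allowed. *)
Section RingIdeals.
Variable R : pzRingType.
Implicit Types (a b c x y : R) (I J : set R).

Definition right_principal x : set R := [set x * r | r in [set: R]].

Definition left_principal x : set R := [set r * x | r in [set: R]].

(* ${}^{\circ}x$ *)
Definition left_annihilator x : set R := [set r | r * x = 0].

(* $x^{\circ}$ *)
Definition right_annihilator x : set R := [set r | x * r = 0].

Definition regular x : Prop := exists z, x * z * x = x.

(* $R = I \oplus J$ *)
Definition is_direct_sum I J : Prop :=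
  [set u + v | u in I & v in J] = [set: R] /\ I `&` J = [set 0].

Definition is_bc_inverse a b c y : Prop :=
  [/\ ([set b * r * y | r in [set: R]] `&` [set y * r * c | r in [set: R]]) y,
      y * a * b = b
    & c * a * y = c].

End RingIdeals.

(* Main.v *)
Require Import Defs.
From mathcomp Require Import all_boot all_algebra.
From mathcomp Require Import boolp classical_sets.

Import GRing.Theory.
Local Open Scope ring_scope.

(** The conditions on right ideals and right annihilators, in (2) as in (3), say
    two things about left multiplication by [a]: it maps [bR] onto [aR], that is,
    [a] lies in [abR], and it is injective on [bR].  The conditions on left
    ideals and left annihilators are the same statement in the converse ring,
    with [c] in place of [b], and are obtained from it by duality.

    An inner [(b,c)]-inverse [y] yields these properties at once: from [y] in
    [bR] and [a = aya] one gets [a] in [abR], and [yab = b] makes [y] a left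
    inverse of [a] on [bR].  Conversely, write [a = abr = sca] and [a = aza].
    Then [y = brzsc] satisfies [aya = a], and since [y] lies both in [bR] and
    in [Rc], the identities [yab = b], [cay = c] and [yay = y] follow by
    cancelling [a]; the last one puts [y] in [bRy] and in [yRc]. *)

Local Open Scope classical_set_scope.

Section RightIdeals.
Variable R : pzRingType.
Implicit Types a b y : R.

Lemma right_principal_mul_eq a b r :
  a * b * r = a -> right_principal a = right_principal (a * b).
Proof.
move=> abr; apply/seteqP; split=> x [t _ <-].
  by exists (r * t) => //; rewrite mulrA abr.
by exists (b * t) => //; rewrite mulrA.
Qed.

Lemma right_annihilator_mul_eq a b y :
  y * a * b = b -> right_annihilator (a * b) = right_annihilator b.
Proof.
move=> yab; apply/seteqP; split=> x; rewrite /right_annihilator /= => e.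
  by rewrite -yab -2!mulrA [a * _]mulrA e mulr0.
by rewrite -mulrA e mulr0.
Qed.

(** If [a = abu], then [1 - bu] takes its values in the kernel of left
    multiplication by [a], so [x = (x - bux) + bux] decomposes every [x]. *)
Lemma direct_sum_annihilator_principal a b :
    right_principal a = right_principal (a * b) ->
    right_annihilator (a * b) = right_annihilator b ->
  is_direct_sum (right_annihilator a) (right_principal b).
Proof.
move=> aR abann; split.
  have [u _ abu] : right_principal (a * b) a.
    by rewrite -aR; exists 1 => //; rewrite mulr1.
  apply/seteqP; split=> // x _.
  exists (x - b * u * x); last first.
    by exists (b * u * x); [exists (u * x) => //; rewrite mulrA | rewrite subrK].
  by rewrite /right_annihilator /= mulrBr !mulrA abu subrr.
apply/seteqP; split=> x /=.
  case=> ax [r _ xE]; have : right_annihilator (a * b) r.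
    by rewrite /right_annihilator /= -mulrA xE.
  by rewrite abann /right_annihilator /= xE.
by move=> ->; split; [exact: mulr0 | exists 0 => //; rewrite mulr0].
Qed.

(** What a direct sum decomposition gives back: decomposing [1] shows that [a]
    lies in [abR], and the trivial intersection lets one cancel [a] on [bR]. *)
Lemma direct_sum_cancel a b :
    is_direct_sum (right_annihilator a) (right_principal b) ->
  (exists r, a * b * r = a) /\
  (forall s t, a * (b * s) = a * (b * t) -> b * s = b * t).
Proof.
move=> [sumT cap0]; split.
  have : [set: R] 1 by [].
  rewrite -sumT => -[u au] [_ [r _ <-]] e1.
  by exists r; rewrite -[RHS]mulr1 -e1 mulrDr au add0r mulrA.
move=> s t e; apply/eqP; rewrite -subr_eq0; apply/eqP.
suff : (right_annihilator a `&` right_principal b) (b * s - b * t).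
  by rewrite cap0.
split; first by rewrite /right_annihilator /= mulrBr e subrr.
by exists (s - t) => //; rewrite mulrBr.
Qed.

End RightIdeals.

Local Close Scope classical_set_scope.

Theorem theorem3p16 (R : pzRingType) (a b c : R) :
  [<-> exists y : R, a * y * a = a /\ is_bc_inverse a b c y;
       [/\ regular a,
           right_principal a = right_principal (a * b),
           left_principal (c * a) = left_principal a,
           right_annihilator (a * b) = right_annihilator b
         & left_annihilator (c * a) = left_annihilator c];
       [/\ regular a,
           is_direct_sum (right_annihilator a) (right_principal b)
         & is_direct_sum (left_annihilator a) (left_principal c)]].
Proof.
tfae.
- case=> y [aya [[[r _ bry] [s _ ysc]] yab cay]]; split.
  + by exists y.
  + apply: (@right_principal_mul_eq _ a b (r * y * a)).
    by rewrite -[RHS]aya -[in RHS]bry !mulrA.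
  + symmetry; apply: (@right_principal_mul_eq R^c a c (a * y * s)).
    by change (a * y * s * (c * a) = a); rewrite -[RHS]aya -[in RHS]ysc !mulrA.
  + exact: right_annihilator_mul_eq yab.
  + apply: (@right_annihilator_mul_eq R^c a c y).
    by change (c * (a * y) = c); rewrite mulrA.
- case=> areg aR Ra annb annc; split=> //.
    exact: direct_sum_annihilator_principal.
  exact: (@direct_sum_annihilator_principal R^c a c (esym Ra) annc).
- case=> -[z aza] /direct_sum_cancel[[r abr] cancelb] sumc.
  (* Multiplication in [R^c] is reversed, so the dual facts are restated with
     the product of [R]. *)
  have [[s sca] cancelc] :
      (exists s : R, s * (c * a) = a) /\
      (forall p q : R, p * c * a = q * c * a -> p * c = q * c)
    := @direct_sum_cancel R^c a c sumc.
  (* The inverse is kept in its two forms [bu] and [wc]: cancelling [a] on the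
     left uses the first, on the right the second. *)
  have [u [w [bu_wc abua]]] :
      exists u w, b * u = w * c /\ a * b * u * a = a.
    exists (r * z * s * c), (b * r * z * s); split; first by rewrite !mulrA.
    by rewrite !mulrA abr -[_ * c * a]mulrA -[_ * s * _]mulrA sca.
  have awca : a * w * c * a = a by rewrite -[a * w * c]mulrA -bu_wc mulrA.
  have yay : b * u * a * (b * u) = b * u.
    by rewrite -2!mulrA; apply: cancelb; rewrite !mulrA abua.
  exists (b * u); split; first by rewrite mulrA.
  split.
  + split; first by exists (u * a) => //; rewrite [b * _]mulrA.
    by exists (a * w) => //; rewrite mulrA -[_ * w * c]mulrA -bu_wc.
  + by rewrite -[RHS]mulr1 -!mulrA; apply: cancelb; rewrite mulr1 !mulrA abua.
  + rewrite bu_wc mulrA -[RHS]mul1r; apply: cancelc.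
    by rewrite mul1r -[in RHS]awca !mulrA.
Qed.
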